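(* Let $\gamma$ be a translation-invariant (nonnull) specification, $\nu\in\mathcal G_{\mathrm{inv}}(\gamma)$ and $\mu,\lambda\in\mathcal M^+_{1,\mathrm{inv}}$, and assume Condition C1': $(\lambda\otimes\mu)\big(\{(\xi,\sigma):\sigma^\xi\in\Omega_\gamma\}\big)=1$. Then: (1) $h(\mu|\nu)$ exists if and only if $e^\lambda_\nu$ exists, and in that case $$h(\mu|\nu)=-h(\mu)+e^\lambda_\nu-\int_{\Omega\times\Omega}\log\frac{\gamma_0(\sigma^\xi|\sigma^\xi)}{\gamma_0(\xi|\sigma^\xi)}\,\mu(d\sigma)\,\lambda(d\xi).$$ (2) If moreover $\mu\in\mathcal G_{\mathrm{inv}}(\gamma)$ and $e^\lambda_\nu$ exists, then $$h(\mu|\nu)=\lim_{n\to\infty}\frac1{|\Lambda_n|}\int_\Omega\log\frac{d\mu_{\Lambda_n}}{d\nu_{\Lambda_n}}(\xi_{\Lambda_n})\,\lambda(d\xi).$$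
   Context: Let $E$ be a finite set, $\Omega=E^{\mathbb Z^d}$ with product topology and Borel $\sigma$-field $\mathcal F$; $\mathcal F_\Lambda$ is generated by the coordinates in $\Lambda$; $\mathcal S$ = finite subsets of $\mathbb Z^d$; $\mu(\sigma_\Lambda)=\mu(\{\omega:\omega_\Lambda=\sigma_\Lambda\})$ and $\mu_\Lambda$ is the law of $\omega_\Lambda$ under $\mu$; local functions are $\mathcal F_\Delta$-measurable for some finite $\Delta$. Translations $(\tau_x\omega)(y)=\omega(x+y)$; $\mathcal M^+_{1,\mathrm{inv}}$ = translation-invariant probability measures. A specification $\gamma=(\gamma_\Lambda)_{\Lambda\in\mathcal S}$ is a family of probability kernels, $\mathcal F_{\Lambda^c}$-measurable in the boundary condition, proper, consistent ($\int\gamma_\Lambda(A|\omega')\gamma_{\Lambda'}(d\omega'|\omega)=\gamma_{\Lambda'}(A|\omega)$ for $\Lambda\subset\Lambda'$ and all $\omega$) and nonnull ($0<a_\Lambda<\inf_{\sigma,\eta}\gamma_\Lambda(\sigma_\Lambda|\eta)\le\sup_{\sigma,\eta}\gamma_\Lambda(\sigma_\Lambda|\eta)<b_\Lambda<1$); translation-invariant means $\gamma_{\Lambda+x}(A|\omega)=\gamma_\Lambda(\tau_xA|\tau_x\omega)$. $\mathcal G(\gamma)$: probability measures $\mu$ with $\mu(A|\mathcal F_{\Lambda^c})=\gamma_\Lambda(A|\cdot)$ $\mu$-a.s. for all $\Lambda,A$; $\mathcal G_{\mathrm{inv}}(\gamma)=\mathcal G(\gamma)\cap\mathcal M^+_{1,\mathrm{inv}}$.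 $\Omega_\gamma$ is the set of $\omega$ at which $\omega'\mapsto\int f\,d\gamma_\Lambda(\cdot|\omega')$ is continuous for all $\Lambda\in\mathcal S$ and local $f$. For $\sigma,\xi\in\Omega$ and the lexicographic order $\le$ on $\mathbb Z^d$, define $\sigma^\xi(x)=\sigma(x)$ if $x\le0$ and $\sigma^\xi(x)=\xi(x)$ if $x>0$. $\gamma_0(\zeta|\omega)$ denotes $\gamma_{\{0\}}(\{\omega':\omega'(0)=\zeta(0)\}|\omega)$. $\Lambda_n=[-n,n]^d\cap\mathbb Z^d$. $e^\lambda_\nu=-\lim_{n\to\infty}|\Lambda_n|^{-1}\int_\Omega\log\nu(\xi_{\Lambda_n})\,\lambda(d\xi)$ whenever the limit exists. $h_\Lambda(\mu|\nu)=\sum_{\sigma_\Lambda}\mu(\sigma_\Lambda)\log\frac{\mu(\sigma_\Lambda)}{\nu(\sigma_\Lambda)}$, $h(\mu|\nu)=\lim_n|\Lambda_n|^{-1}h_{\Lambda_n}(\mu|\nu)$ when it exists, and $h(\mu)=-\lim_n|\Lambda_n|^{-1}\sum_{\sigma_{\Lambda_n}}\mu(\sigma_{\Lambda_n})\log\mu(\sigma_{\Lambda_n})$ is the Kolmogorov–Sinai entropy. *)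

(* Defs.v *)
From HB Require Import structures.
From mathcomp Require Import all_boot all_order all_algebra.
From mathcomp Require Import finmap.
From mathcomp Require Import all_classical all_reals all_analysis.
Set Implicit Arguments. Unset Strict Implicit. Unset Printing Implicit Defensive.
Import Order.TTheory GRing.Theory Num.Theory.
Import numFieldNormedType.Exports.
Local Open Scope classical_set_scope.
Local Open Scope ring_scope.

Definition Zd (d : nat) := 'rV[int]_d.

Section Conf.
Variables (d : nat) (E : finType) (e0 : E).

(** Configurations Omega = E^(Z^d).  The element e0 : E is only used to
    equip the type with a default point (required by MathComp-Analysis
    measurable types); nothing depends on its choice. *)
Definition Conf of E := Zd d -> E.
Local Notation conf := (Conf e0).
HB.instance Definition _ := Choice.on conf.
HB.instance Definition _ := isPointed.Build conf (fun _ => e0).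

Definition coordgen (D : set (Zd d)) : set (set conf) :=
  fun A => exists x e, D x /\ A = [set w : conf | w x = e].

Definition sigmaF (D : set (Zd d)) : set (set conf) := <<s coordgen D >>.

(** Omega with the product (= Borel, E finite discrete) sigma-field F. *)
Definition Omega := g_sigma_algebraType (coordgen setT).
HB.instance Definition _ := Measurable.copy Omega
  (g_sigma_algebraType (coordgen setT)).

Definition tau (x : Zd d) (w : Omega) : Omega := fun y => w (x + y).

Definition Fmeasurable (D : set (Zd d)) dU (U : measurableType dU)
    (f : Omega -> U) :=
  forall B : set U, measurable B -> sigmaF D (f @^-1` B).

Definition local_fun (R : realType) (f : Omega -> R) :=
  exists Delta : {fset Zd d}, Fmeasurable (U := R) [set x | x \in Delta] f.

Definition cyl (L : {fset Zd d}) (sigma : Omega) : set Omega :=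
  [set w | forall x, x \in L -> w x = sigma x].

(** The box Lambda_n = [-n,n]^d, enumerated by the finite type Box n. *)
Definition Box (n : nat) := {ffun 'I_d -> 'I_(n.*2.+1)}.
Definition site (n : nat) (b : Box n) : Zd d :=
  \row_i ((b i : nat)%:Z - n%:Z).
Definition Pat (n : nat) := {ffun Box n -> E}.
Definition cylB (n : nat) (p : Pat n) : set Omega :=
  [set w | forall b : Box n, w (site b) = p b].
Definition restr (n : nat) (w : Omega) : Pat n := [ffun b => w (site b)].
Definition vol (R : realType) (n : nat) : R := ((n.*2.+1) ^ d)%:R.

(** Continuity at w in the product topology (cylinders on Lambda_n form a
    neighbourhood base of w, E being discrete). *)
Definition cont_at (R : realType) (g : Omega -> R) (w : Omega) :=
  forall eps : R, 0 < eps -> exists n : nat, forall w' : Omega,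
    (forall b : Box n, w' (site b) = w (site b)) -> `|g w' - g w| < eps.

Definition lexle (x y : Zd d) : bool :=
  (x == y) || [exists i : 'I_d,
     [forall j : 'I_d, (j < i)%N ==> (x ord0 j == y ord0 j)] &&
     (x ord0 i < y ord0 i)].
Definition splice (sigma xi : Omega) : Omega :=
  fun x => if lexle x 0 then sigma x else xi x.

Section Spec.
Variable R : realType.
Local Open Scope ereal_scope.
Variable gamma : {fset Zd d} -> Omega -> probability Omega R.

Definition compl (L : {fset Zd d}) : set (Zd d) := ~` [set x | x \in L].

Definition is_specification :=
  (forall L (A : set Omega), measurable A ->
     Fmeasurable (U := R) (compl L) (fun w => fine (gamma L w A))) /\
  (forall L (A : set Omega) (w : Omega), sigmaF (compl L) A ->
     gamma L w A = (\1_A w)%:E) /\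
  (forall L L' : {fset Zd d}, (L `<=` L')%fset ->
     forall (A : set Omega), measurable A -> forall w : Omega,
       \int[gamma L' w]_w' gamma L w' A = gamma L' w A) /\
  (forall L : {fset Zd d}, L != fset0 ->
     exists a b : R, (0 < a)%R /\ (b < 1)%R /\
       forall sigma eta : Omega,
         a%:E < gamma L eta (cyl L sigma) < b%:E).

Definition spec_translation_invariant :=
  forall (L : {fset Zd d}) (x : Zd d) (A : set Omega) (w : Omega),
    measurable A ->
    gamma [fset (y + x)%R | y in L]%fset w A = gamma L (tau x w) (tau x @` A).

(** mu in G(gamma): gamma_Lambda(A|.) is a version of mu(A|F_{Lambda^c}). *)
Definition is_gibbs (mu : probability Omega R) :=
  forall (L : {fset Zd d}) (A : set Omega), measurable A ->
    forall B : set Omega, sigmaF (compl L) B ->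
      \int[mu]_(w in B) gamma L w A = mu (A `&` B).

Definition gamma0 (zeta w : Omega) : R :=
  fine (gamma [fset (0%R : Zd d)]%fset w [set w' | w' (0%R : Zd d) = zeta (0%R : Zd d)]).

Definition Omega_gamma : set Omega :=
  [set w | forall (L : {fset Zd d}) (f : Omega -> R), local_fun f ->
     cont_at (fun w' => Rintegral (gamma L w') setT f) w].

Definition condC1' (lambda mu : probability Omega R) :=
  exists A : set (Omega * Omega), measurable A /\
    A `<=` [set p | Omega_gamma (splice p.2 p.1)] /\
    (lambda \x mu) A = 1.

End Spec.

Section Entropies.
Variable R : realType.

Definition mu_inv (mu : probability Omega R) :=
  forall (x : Zd d) (A : set Omega), measurable A ->
    mu (tau x @^-1` A) = mu A.

Definition pr (mu : probability Omega R) (A : set Omega) : R := fine (mu A).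

(** h_{Lambda_n}(mu|nu), with the convention 0 log 0 = 0. *)
Definition hLam (mu nu : probability Omega R) (n : nat) : R :=
  \sum_(p : Pat n)
    (if pr mu (cylB p) == 0 then 0
     else pr mu (cylB p) * ln (pr mu (cylB p) / pr nu (cylB p))).

Definition hrel_seq (mu nu : probability Omega R) (n : nat) : R :=
  hLam mu nu n / vol R n.

Definition hKS_seq (mu : probability Omega R) (n : nat) : R :=
  - (\sum_(p : Pat n)
       (if pr mu (cylB p) == 0 then 0
        else pr mu (cylB p) * ln (pr mu (cylB p)))) / vol R n.
Definition hKS (mu : probability Omega R) : R := limn (hKS_seq mu).

Definition e_seq (lambda nu : probability Omega R) (n : nat) : R :=
  - (Rintegral lambda setT (fun xi => ln (pr nu (cylB (restr n xi))))) / vol R n.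

(** (1/|Lambda_n|) int log (d mu_{Lambda_n}/d nu_{Lambda_n})(xi_{Lambda_n}) lambda(dxi);
    on the finite space E^{Lambda_n} the density is the ratio of the weights. *)
Definition rn_seq (lambda mu nu : probability Omega R) (n : nat) : R :=
  Rintegral lambda setT
    (fun xi => ln (pr mu (cylB (restr n xi)) / pr nu (cylB (restr n xi))))
  / vol R n.

End Entropies.
End Conf.

(* Main.v *)
Require Import Defs.
From HB Require Import structures.
From mathcomp Require Import all_boot all_order all_algebra.
From mathcomp Require Import finmap.
From mathcomp Require Import all_classical all_reals all_analysis.
From mathcomp Require Import measurable_realfun.
From mathcomp Require Import zify ring lra.
Import Order.TTheory GRing.Theory Num.Theory.
Import numFieldNormedType.Exports.
Local Open Scope classical_set_scope.
Local Open Scope ring_scope.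

Set Implicit Arguments.
Unset Strict Implicit.
Unset Printing Implicit Defensive.

(** Writing [m V w] for the [nu]-probability of the cylinder of [w] on [V], one passes
    from [xi] to [sigma] in the box by replacing the values one site at a time in
    lexicographic order, so that [ln (m V sigma) - ln (m V xi)] telescopes into
    one term per site [x].  After translating [x] to the origin, this term is the
    logarithm of a ratio of [nu]-conditional probabilities of the spin at [0] given
    [splice sigma xi] on [V - x]; it is bounded by nonnullness and, by the Gibbs
    property, tends to the integrand of the theorem as [V - x] grows, whenever
    [splice sigma xi] is a continuity point.  Dominated convergence and the negligible
    size of the boundary of a box give that [e_seq lambda nu - e_seq mu nu]
    converges to the double integral.  The same telescoping, with
    conditional entropies that decrease in the conditioning set, gives the
    existence of the entropy of [mu], and [hrel_seq mu nu] is
    [- hKS_seq mu + e_seq mu nu].  The second part is this limit for [nu] minus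
    the same limit for [mu]. *)

(** * Lexicographic order and boxes *)

Section Lattice.
Variable d : nat.
Implicit Types (x y z : Zd d) (V W : {fset Zd d}) (n k : nat).

Lemma lexlexx : reflexive (@lexle d).
Proof. by move=> x; rewrite /lexle eqxx. Qed.

Lemma lexleP x y : reflect
  (x = y \/ exists i : 'I_d, (forall j : 'I_d, (j < i)%N -> x ord0 j = y ord0 j) /\
                      x ord0 i < y ord0 i)
  (lexle x y).
Proof.
apply: (iffP orP) => -[].
- by move/eqP; left.
- move=> /existsP[i /andP[/forallP h xy]]; right; exists i; split=> // j ji.
  by move: (h j); rewrite ji /= => /eqP.
- by move=> ->; left.
- move=> [i [h xy]]; right; apply/existsP; exists i; rewrite xy andbT.
  by apply/forallP => j; apply/implyP => /h ->.
Qed.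

Lemma lexle_trans : transitive (@lexle d).
Proof.
move=> y x z /lexleP[->//|[i [hi xyi]]] /lexleP[<-|[j [hj yzj]]]; apply/lexleP.
  by right; exists i.
right; case: (ltngtP i j) => ij.
- exists i; split; last by rewrite -hj.
  by move=> k ki; rewrite hi// hj// (ltn_trans ki).
- exists j; split; last by rewrite hi.
  by move=> k kj; rewrite hi ?hj// (ltn_trans kj).
- move/val_inj : ij => ij; subst j; exists i; split; last exact: lt_trans yzj.
  by move=> k ki; rewrite hi// hj.
Qed.

Lemma lexle_anti : antisymmetric (@lexle d).
Proof.
move=> x y /andP[/lexleP[//|[i [hi xyi]]] /lexleP[//|[j [hj yxj]]]].
case: (ltngtP i j) => ij.
- by move: xyi; rewrite hj// ltxx.
- by move: yxj; rewrite hi// ltxx.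
- move/val_inj : ij => ij; subst j.
  by move: (lt_trans xyi yxj); rewrite ltxx.
Qed.

(** Distinct points are compared at the first coordinate where they differ. *)
Lemma lexle_total : total (@lexle d).
Proof.
move=> x y; have [->|xy] := eqVneq x y; first by rewrite lexlexx.
have [i0 xyi0] : exists i, x ord0 i != y ord0 i.
  apply/existsP; apply: contraT => /existsPn h.
  by case/eqP: xy; apply/rowP => i; apply/eqP; move: (h i); rewrite negbK.
have [i xyi mini] := @arg_minnP _ i0 (fun i => x ord0 i != y ord0 i)
  (fun i : 'I_d => i : nat) xyi0.
have agree (j : 'I_d) : (j < i)%N -> x ord0 j = y ord0 j.
  by move=> ji; apply/eqP; apply: contraTT ji => /mini; rewrite -leqNgt.
case: (ltgtP (x ord0 i) (y ord0 i)) => [lt|lt|/eqP]; last by rewrite (negbTE xyi).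
- by apply/orP; left; apply/lexleP; right; exists i.
- by apply/orP; right; apply/lexleP; right; exists i; split=> // j /agree.
Qed.

(** Translation invariance of the order lets each one-site replacement be moved to the origin. *)
Lemma lexle_subr0 x y : lexle (y - x) 0 = lexle y x.
Proof.
rewrite /lexle subr_eq0; congr orb; apply: eq_existsb => i; rewrite !mxE.
rewrite subr_lt0; congr andb; apply: eq_forallb => j; rewrite !mxE.
by rewrite subr_eq0.
Qed.

(** Once [V] is sorted, consecutive initial segments differ by a single site, so an ordinary
    telescoping sum along the list can be indexed by sites. *)
Lemma lex_telescope (M : zmodType) (Phi : {fset Zd d} -> M) V :
  Phi V - Phi fset0 =
  \sum_(x <- V) (Phi [fset y in V | lexle y x]%fset
                 - Phi [fset y in V | lexle y x && (y != x)]%fset).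
Proof.
set s := sort (@lexle d) V.
have us : uniq s by rewrite sort_uniq fset_uniq.
have ms y : (y \in s) = (y \in V) by rewrite mem_sort.
have ss : sorted (@lexle d) s := sort_sorted lexle_total V.
pose U k := Phi [fset y in V | (index y s < k)%N]%fset.
have -> : Phi V - Phi fset0 = U (size s) - U 0%N.
  rewrite /U; congr (Phi _ - Phi _); apply/fsetP => y; rewrite !inE /=.
    by rewrite index_mem ms andbb.
  by rewrite andbF.
rewrite -telescope_sumr// [RHS](perm_big s) /=; last by rewrite perm_sym perm_sort.
rewrite [RHS](big_nth 0) !big_mkord; apply: eq_bigr => i _.
set x := nth 0 s i.
have ix : index x s = i by rewrite index_uniq.
have lei y : y \in V -> (index y s <= i)%N = lexle y x.
  rewrite -ms => ys; apply/idP/idP => [yi|yx].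
    rewrite -[y in lexle y _](nth_index 0 ys).
    by apply: (sorted_leq_nth lexle_trans lexlexx) => //; rewrite inE ?index_mem.
  rewrite leqNgt; apply/negP => iy.
  have xy : lexle x y.
    rewrite -[y in lexle _ y](nth_index 0 ys).
    apply: (sorted_leq_nth lexle_trans lexlexx) => //; rewrite ?inE ?index_mem//.
    exact: ltnW.
  have /esym E : y = x by apply: lexle_anti; rewrite yx.
  by move: iy; rewrite -ix E ltnn.
rewrite /U; congr (Phi _ - Phi _); apply/fsetP => y; rewrite !inE /=;
  case: (boolP (y \in V)) => //= yV.
  by rewrite ltnS lei.
rewrite -lei// ltn_neqAle andbC; congr andb.
apply/idP/idP; first by apply: contraNneq => ->; rewrite ix.
by apply: contraNneq => E; rewrite /x -E nth_index// ms.
Qed.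

Definition boxset n : {fset Zd d} := [fset site b | b in Box d n]%fset.

Lemma in_boxset n x : (x \in boxset n) = [forall i, `|x ord0 i| <= n%:Z].
Proof.
apply/imfsetP/forallP => [[b _ ->] i|h].
  by rewrite !mxE /=; case: (b i) => m /=; rewrite ler_norml; lia.
have xb i : (`|(x ord0 i + n%:Z)%R| < n.*2.+1)%N by move: (h i); lia.
exists [ffun i => Ordinal (xb i)] => //; apply/rowP => i.
rewrite !mxE ffunE /= gez0_abs ?addrK//.
by move: (h i); rewrite ler_norml => /andP[+ _]; rewrite lerNl -subr_ge0 opprK addrC.
Qed.

Lemma boxset0 n : 0 \in boxset n.
Proof. by rewrite in_boxset; apply/forallP => i; rewrite mxE normr0. Qed.

Lemma boxsetD n k x y : x \in boxset n -> y \in boxset k -> x + y \in boxset (n + k).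
Proof.
rewrite !in_boxset => /forallP hx /forallP hy; apply/forallP => i; rewrite mxE.
by rewrite (le_trans (ler_normD _ _))// PoszD lerD.
Qed.

Lemma boxset_sub n k : (n <= k)%N -> (boxset n `<=` boxset k)%fset.
Proof.
move=> nk; apply/fsubsetP => x; rewrite !in_boxset => /forallP h.
by apply/forallP => i; rewrite (le_trans (h i))// lez_nat.
Qed.

Lemma fset_sub_boxset V : exists n, (V `<=` boxset n)%fset.
Proof.
exists (\max_(x <- V) \max_(i < d) `|x ord0 i|)%N; apply/fsubsetP => x xV.
rewrite in_boxset; apply/forallP => i.
rewrite -abszE lez_nat; apply: (bigmaxn_sup_seq x) => //.
exact: (@leq_bigmax _ (fun i => `|x ord0 i|%N)).
Qed.

Lemma card_boxset n : #|` boxset n| = (n.*2.+1 ^ d)%N.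
Proof.
rewrite card_imfset /=; last first.
  move=> b b' /rowP bb; apply/ffunP => i; apply: val_inj.
  by move: (bb i); rewrite !mxE /= => /addIr [].
by rewrite -cardE card_ffun !card_ord.
Qed.

(** This is [V] seen from [x]: the site [x] becomes the origin. *)
Definition fset_shift V x : {fset Zd d} := [fset y - x | y in V]%fset.

Lemma in_fset_shift V x y : (y \in fset_shift V x) = (y + x \in V).
Proof.
apply/imfsetP/idP => [[z zV ->]|yxV]; first by rewrite subrK.
by exists (y + x); rewrite ?addrK.
Qed.

Lemma sum_notin_fset V W : (W `<=` V)%fset ->
  (\sum_(x <- V) (x \notin W))%N = (#|` V| - #|` W|)%N.
Proof.
move=> WV; have -> : (\sum_(x <- V) (x \notin W))%N = count (predC (mem W)) V.
  by rewrite -sum1_count [RHS]big_mkcond /=; apply: eq_bigr => x _; case: (_ \in _).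
rewrite -[#|` V|](count_predC (mem W)); suff -> : count (mem W) V = #|` W|.
  by rewrite addKn.
rewrite -size_filter; apply: perm_size; apply: uniq_perm => //.
  by rewrite filter_uniq// fset_uniq.
by move=> x; rewrite mem_filter /= andb_idr// => /(fsubsetP WV).
Qed.

End Lattice.

(** * Averages over boxes and negligible boundaries *)

Section Averages.
Variables (R : realType) (d : nat).

Lemma vol_gt0 n : 0 < vol d R n.
Proof. by rewrite ltr0n expn_gt0. Qed.

(** Bernoulli's inequality, applied below to the ratio of two side lengths. *)
Lemma onem_exp_le (r : R) (m : nat) : 0 <= r <= 1 -> 1 - r ^+ m <= m%:R * (1 - r).
Proof.
move=> /andP[r0 r1]; elim: m => [|m ih]; first by rewrite expr0 subrr mul0r.
have rm : r * (1 - r ^+ m) <= 1 - r ^+ m.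
  by rewrite ler_piMl// subr_ge0 exprn_ile1.
by rewrite exprS -natr1; nra.
Qed.

(** The ratio is the [d]-th power of a ratio of side lengths that differs from 1 by [2k / (2n + 1)],
    so Bernoulli's inequality gives a squeeze. *)
Lemma vol_ratio_cvg k : vol d R (n - k) / vol d R n @[n --> \oo] --> (1 : R).
Proof.
have -> : (1 : R) = 1 - (d * k.*2)%:R * 0 by rewrite mulr0 subr0.
apply: (@squeeze_cvgr _ _ _ _ (fun n => 1 - (d * k.*2)%:R * n.+1%:R^-1) (fun=> 1)).
- near=> n.
  have kn : (k <= n)%N by near: n; exact: nbhs_infty_ge.
  rewrite /vol !natrX -expr_div_n; set r := (n - k).*2.+1%:R / _.
  have n0 : 0 < (n.*2.+1%:R : R) by rewrite ltr0n.
  have r01 : 0 <= r <= 1.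
    by rewrite divr_ge0 ?ler0n//= ler_pdivrMr// mul1r ler_nat; lia.
  rewrite exprn_ile1 ?andbT; try by case/andP: r01.
  rewrite lerBlDl -lerBlDr (le_trans (onem_exp_le d r01))//.
  rewrite natrM -mulrA ler_wpM2l//.
  have -> : 1 - r = k.*2%:R / n.*2.+1%:R.
    rewrite /r -[X in X - _](divff (lt0r_neq0 n0)) -mulrBl; congr (_ / _).
    by rewrite -natrB; [congr (_%:R); lia | lia].
  by rewrite ler_wpM2l// lef_pV2 ?posrE// ?ltr0n// ler_nat; lia.
- apply: cvgB; first exact: cvg_cst.
  by apply: cvgM; [exact: cvg_cst | exact: cvg_harmonic].
- by rewrite mulr0 subr0; exact: cvg_cst.
Unshelve. all: by end_near. Qed.

(* All but a boundary layer of negligible proportion of the translates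
   [fset_shift (boxset n) x], [x] in [boxset n], contain a given [boxset k]. *)
Lemma box_average_cvg (c : {fset Zd d} -> R) (l C : R) :
  (forall V, 0 \in V -> `|c V| <= C) ->
  (forall eps, 0 < eps -> exists k, forall V, (boxset d k `<=` V)%fset ->
     `|c V - l| <= eps) ->
  (\sum_(x <- boxset d n) c (fset_shift (boxset d n) x)) / vol d R n
    @[n --> \oo] --> l.
Proof.
move=> cC cl; apply/cvgrPdist_le => eps eps0.
have e20 : 0 < eps / 2 by rewrite divr_gt0.
have [k hk] := cl _ e20.
(* The bound [C] is available only for sets containing the origin; [boxset d 0] is one. *)
have C0 : 0 <= C by apply: le_trans (cC _ (boxset0 d 0)).
have D0 : 0 < C + `|l| + 1 by rewrite ltr_wpDl// addr_ge0.
(* With this tolerance the whole boundary layer, at cost [C + |l| + 1] per site, contributes at most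
   half of [eps]. *)
have /cvgrPdist_le /(_ (eps / 2 / (C + `|l| + 1))) := vol_ratio_cvg k.
rewrite divr_gt0// => /(_ isT) hv; near=> n.
have kn : (k <= n)%N by near: n; exact: nbhs_infty_ge.
have v0 := vol_gt0 n.
have cardv m : (#|` boxset d m|)%:R = vol d R m by rewrite card_boxset.
have -> : l - (\sum_(x <- boxset d n) c (fset_shift (boxset d n) x)) / vol d R n =
    (\sum_(x <- boxset d n) (l - c (fset_shift (boxset d n) x))) / vol d R n.
  rewrite sumrB mulrBl; congr (_ - _).
  rewrite big_const_seq count_predT iter_addr_0 -[size _]/(#|` boxset d n|).
  by rewrite -mulr_natr cardv mulfK// gt_eqF.
rewrite normrM normfV (gtr0_norm v0) ler_pdivrMr//.
apply: (le_trans (ler_norm_sum _ _ _)).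
(* Interior sites are within [eps / 2] of the limit; boundary sites only obey the crude bound. *)
have termle x : x \in boxset d n -> `|l - c (fset_shift (boxset d n) x)| <=
    eps / 2 + (C + `|l| + 1) * (x \notin boxset d (n - k))%:R.
  move=> xn; have [xk|xk] := boolP (x \in boxset d (n - k)).
    rewrite mulr0 addr0 distrC hk//; apply/fsubsetP => y yk.
    by rewrite in_fset_shift -(subnKC kn) boxsetD.
  have := cC (fset_shift (boxset d n) x); rewrite in_fset_shift add0r xn => /(_ isT).
  have := ler_normB l (c (fset_shift (boxset d n) x)); rewrite mulr1; lra.
rewrite big_seq (le_trans (ler_sum _ termle))// -big_seq big_split /=.
rewrite -[X in _ + X <= _]mulr_sumr -natr_sum sum_notin_fset ?boxset_sub ?leq_subr//.
rewrite natrB ?fsubset_leq_card ?boxset_sub ?leq_subr// !cardv.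
rewrite big_const_seq count_predT iter_addr_0 -[size _]/(#|` boxset d n|).
rewrite -[X in X + _]mulr_natr cardv.
have hvn : `|1 - vol d R (n - k) / vol d R n| <= eps / 2 / (C + `|l| + 1).
  by near: n.
have := le_trans (ler_norm _) hvn.
rewrite ler_pdivlMr// -[X in X - _](divff (lt0r_neq0 v0)) -mulrBl mulrAC ler_pdivrMr//.
by rewrite [(_ - _) * (_ + 1)]mulrC; lra.
Unshelve. all: by end_near. Qed.

End Averages.

(** * Integrals of bounded and of finitely valued functions *)

Section Integrals.
Context (dT : measure_display) (T : measurableType dT) (R : realType).

Lemma bounded_integrable (m : {measure set T -> \bar R}) (f : T -> R) (C : R) :
  m setT = 1%E -> measurable_fun setT f -> (forall x, `|f x| <= C) ->
  m.-integrable setT (EFin \o f).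
Proof.
move=> m1 mf fC; apply: measurable_bounded_integrable => //.
  by rewrite m1 ltry.
exists C; split; first exact: num_real.
by move=> M CM x _; exact: le_trans (fC x) (ltW CM).
Qed.

Lemma normr_Rintegral_le (m : {measure set T -> \bar R}) (f : T -> R) (C : R) :
  m setT = 1%E -> measurable_fun setT f -> (forall x, `|f x| <= C) ->
  `|Rintegral m setT f| <= C.
Proof.
move=> m1 mf fC; have fi := bounded_integrable m1 mf fC.
apply: (le_trans (le_normr_Rintegral measurableT fi)).
have -> : C = Rintegral m setT (fun=> C) by rewrite Rintegral_cst// m1 mulr1.
apply: le_Rintegral => //.
  apply: (@bounded_integrable m (fun x => `|f x|) C) => //.
    exact: measurableT_comp.
  by move=> x; rewrite normr_id.
exact: (@bounded_integrable m (fun=> C) `|C|).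
Qed.

Section Finite.
Variables (K : finType) (X : T -> K) (G : K -> R).
Hypothesis mX : forall k, measurable (X @^-1` [set k]).

Lemma measurable_fin_comp (dU : measure_display) (U : measurableType dU) (H : K -> U) :
  measurable_fun setT (H \o X).
Proof.
move=> _ B mB; rewrite setTI.
have -> : (H \o X) @^-1` B = \bigcup_(k in H @^-1` B) X @^-1` [set k].
  apply/seteqP; split=> [x /= HB|x [k kB Xk]]; first by exists (X x).
  by rewrite /preimage /= Xk.
by apply: fin_bigcup_measurable => // k _; exact: mX.
Qed.

Lemma integrable_fin_comp (m : {measure set T -> \bar R}) : m setT = 1%E ->
  m.-integrable setT (EFin \o (G \o X)).
Proof.
move=> m1; apply: (@bounded_integrable _ _ (\sum_k `|G k|)) => //.
  exact: measurable_fin_comp.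
by move=> x; rewrite /= (bigD1 (X x))//= lerDl sumr_ge0.
Qed.

Lemma Rintegral_fin_comp (m : probability T R) :
  Rintegral m setT (G \o X) = \sum_k fine (m (X @^-1` [set k])) * G k.
Proof.
have -> : Rintegral m setT (G \o X) = fine (\int[m]_x
    (\sum_k ((G k)%:E * (\1_(X @^-1` [set k]) x)%:E)))%E.
  congr fine; apply: eq_integral => x _.
  rewrite (bigD1 (X x))//= indicE mem_set// mule1 big1 ?adde0// => k kX.
  by rewrite indicE memNset ?mule0//= => /eqP; rewrite eq_sym (negbTE kX).
have ind k : m.-integrable setT (EFin \o \1_(X @^-1` [set k])).
  apply: (@bounded_integrable _ _ 1) => //; first exact: probability_setT.
  by move=> x; rewrite indicE ger0_norm//; case: (_ \in _).
rewrite integral_sum//; last by move=> k; exact: (integrableZl measurableT (G k) (ind k)).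
rewrite (eq_bigr (fun k => (fine (m (X @^-1` [set k])) * G k)%:E)); last first.
  move=> k _; rewrite (integralZl measurableT (ind k)) /= integral_indic// setIT.
  rewrite EFinM fineK ?fin_num_measure//.
  by rewrite muleC.
by rewrite sumEFin.
Qed.

End Finite.

(** This is the finite integral formula for the pair [Y] of [X] and membership in [A], with the
    second component as integrand. *)
Lemma fine_measure_partition (K : finType) (X : T -> K) (A : set T)
    (m : probability T R) : (forall k, measurable (X @^-1` [set k])) -> measurable A ->
  fine (m A) = \sum_k fine (m (A `&` X @^-1` [set k])).
Proof.
move=> mX mA; pose Y x := (X x, x \in A).
have mY k : measurable (Y @^-1` [set k]).
  case: k => k [].
    rewrite (_ : _ @^-1` _ = X @^-1` [set k] `&` A); first exact: measurableI.
    apply/seteqP; split=> x /=; first by case=> -> /set_mem.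
    by move=> [Xk /mem_set xA]; rewrite /preimage /= /Y Xk xA.
  rewrite (_ : _ @^-1` _ = X @^-1` [set k] `\` A); first exact: measurableD.
  apply/seteqP; split=> x /=; first by case=> -> /negbT; rewrite notin_setE.
  by move=> [Xk xA]; rewrite /preimage /= /Y Xk memNset.
have := @Rintegral_fin_comp _ Y (fun k => k.2%:R) mY m.
have -> : Rintegral m setT ((fun k : K * bool => k.2%:R) \o Y) = fine (m A).
  by rewrite /Rintegral -[A in RHS]setIT -integral_indic.
move=> ->.
rewrite (eq_bigr (fun k => fine (m (Y @^-1` [set (k.1, k.2)])) * k.2%:R)); last by case.
rewrite -(pair_bigA _ (fun k b => fine (m (Y @^-1` [set (k, b)])) * b%:R)) /=.
apply: eq_bigr => k _; rewrite big_bool /= mulr1 mulr0 addr0; congr (fine (m _)).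
apply/seteqP; split=> x /=; first by case=> -> /set_mem.
by move=> [/mem_set xA Xk]; rewrite /preimage /= /Y Xk xA.
Qed.

End Integrals.

Lemma Rintegral_image (d1 d2 : measure_display) (T1 : measurableType d1)
    (T2 : measurableType d2) (R : realType) (phi : T1 -> T2)
    (m1 : {measure set T1 -> \bar R}) (m2 : {measure set T2 -> \bar R}) (f : T2 -> R) :
  measurable_fun setT phi ->
  (forall A, measurable A -> m1 (phi @^-1` A) = m2 A) ->
  measurable_fun setT f ->
  m1.-integrable setT (EFin \o (f \o phi)) ->
  Rintegral m1 setT (f \o phi) = Rintegral m2 setT f.
Proof.
move=> mphi m12 mf fi; congr fine.
have /measurable_EFinP mEf := mf.
have := integral_pushforward mphi mEf fi measurableT.
rewrite preimage_setT => /esym H; rewrite [LHS]H.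
by apply: eq_measure_integral => A mA _; exact: m12.
Qed.

(** * Cylinder events *)

Section Cylinders.
Context (R : realType) (d : nat) (E : finType) (e0 : E).
Local Notation Om := (Omega d e0).
Local Notation sigmaF := (@sigmaF d E e0).
Implicit Types (V W : {fset Zd d}) (w z : Om) (D : set (Zd d)).

Lemma sigmaF_measurable D (A : set Om) : sigmaF D A -> measurable A.
Proof.
apply: smallest_sub; first exact: smallest_sigma_algebra.
by move=> B [x [e [_ ->]]]; apply: sub_sigma_algebra; exists x, e.
Qed.

Lemma sigmaF_coord D x e : D x -> sigmaF D [set w : Om | w x = e].
Proof. by move=> Dx; apply: sub_sigma_algebra; exists x, e. Qed.

Lemma measurable_coord x e : measurable [set w : Om | w x = e].
Proof. exact: (@sigmaF_measurable setT _ (sigmaF_coord _ _)). Qed.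

Lemma sigmaF_cyl D V w : (forall x, x \in V -> D x) -> sigmaF D (cyl V w).
Proof.
(* On this copy of the space, [sigmaF D] is the ambient sigma-algebra, so the closure lemmas for
   measurable sets apply to it. *)
move=> VD; pose T := g_sigma_algebraType (@coordgen d E e0 D).
pose F x : set T := [set w' | w' x = w x].
suff : measurable (\bigcap_(x in [set` V]) F x) by [].
apply: fin_bigcap_measurable; first exact: finite_fset.
by move=> x xV; apply: sigmaF_coord; exact: VD.
Qed.

Lemma measurable_cyl V w : measurable (cyl V w).
Proof. exact: (@sigmaF_measurable setT _ (sigmaF_cyl _ _)). Qed.

(** The sets that do not separate configurations agreeing on [D] form a sigma-algebra containing the
    generators. *)
Lemma sigmaF_agree D (A : set Om) w w' : sigmaF D A ->
  (forall x, D x -> w x = w' x) -> A w <-> A w'.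
Proof.
pose X : set (set (Conf d e0)) := [set A | forall w w' : Om,
  (forall x, D x -> w x = w' x) -> A w <-> A w'].
suff : sigmaF D `<=` X by move=> sX sA; apply: (sX A sA).
apply: smallest_sub.
  split=> [//|B XB v v' vv'|F XF v v' vv'].
    by split=> -[_ nB]; split=> // /(XB _ _ vv').
  by split=> -[i _ Fi]; exists i => //; apply/(XF i _ _ vv').
by move=> _ [x [e [Dx ->]]] v v' vv' /=; rewrite vv'.
Qed.

Lemma Fmeasurable_agree D (f : Om -> R) w w' : Fmeasurable (U := R) D f ->
  (forall x, D x -> w x = w' x) -> f w = f w'.
Proof.
move=> mf ww'.
have [h _] := sigmaF_agree (mf _ (measurable_set1 (f w))) ww'.
by apply/esym/h.
Qed.

Lemma measurable_to_Omega (dT : measure_display) (T : measurableType dT) (f : T -> Om) :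
  (forall x e, measurable [set t | f t x = e]) -> measurable_fun setT f.
Proof.
move=> mf; apply: (@measurability _ _ T Om setT f (@coordgen d E e0 setT)) => //.
by move=> _ [_ [x [e [_ ->]]] <-]; rewrite setTI; exact: mf.
Qed.

Lemma measurable_tau x : measurable_fun setT (@tau d E e0 x).
Proof. by apply: measurable_to_Omega => y e; exact: measurable_coord. Qed.

Definition upd0 (w : Om) (e : E) : Om := fun y => if y == 0 then e else w y.

Lemma upd0_id w : upd0 w (w 0) = w.
Proof. by apply/funext => y; rewrite /upd0; case: eqP => [->|]. Qed.

Lemma measurable_splice : measurable_fun setT (fun p : Om * Om => splice p.2 p.1).
Proof.
apply: measurable_to_Omega => x e; rewrite /splice; case: lexle.
  have := measurable_snd (T1 := Om) measurableT _ (measurable_coord x e).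
  by rewrite setTI.
have := measurable_fst (T2 := Om) measurableT _ (measurable_coord x e).
by rewrite setTI.
Qed.

Lemma measurable_upd0_splice :
  measurable_fun setT (fun p : Om * Om => upd0 (splice p.2 p.1) (p.1 0)).
Proof.
apply: measurable_to_Omega => x e; rewrite /upd0; case: (x == 0).
  have := measurable_fst (T2 := Om) measurableT _ (measurable_coord 0 e).
  by rewrite setTI.
have := measurable_splice measurableT (measurable_coord x e).
by rewrite setTI.
Qed.

Lemma cyl_agree V w w' : {in V, w =1 w'} -> cyl V w = cyl V w'.
Proof.
move=> ww'; apply/seteqP; split=> v /= vw x xV; rewrite vw//.
  exact: ww'.
by apply/esym/ww'.
Qed.

Definition pat V (w : Om) : {ffun V -> E} := [ffun x : V => w (val x)].

(** The value [e0] off [V] is a placeholder that does not affect the cylinder on [V]. *)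
Definition patext V (q : {ffun V -> E}) : Om := fun x => oapp q e0 (insub x).

Lemma patextE V (q : {ffun V -> E}) (x : V) : patext q (val x) = q x.
Proof. by rewrite /patext valK. Qed.

Lemma patext_pat V w : {in V, patext (pat V w) =1 w}.
Proof.
by move=> x xV; rewrite -[x]/(val [` xV]%fset) patextE ffunE.
Qed.

Lemma preimage_pat V (q : {ffun V -> E}) : pat V @^-1` [set q] = cyl V (patext q).
Proof.
apply/seteqP; split=> [w /= <- x xV|w /= wq].
  by rewrite patext_pat.
by apply/ffunP => x; rewrite ffunE wq ?patextE//; exact: valP.
Qed.

Lemma measurable_pat V (q : {ffun V -> E}) : measurable (pat V @^-1` [set q]).
Proof. by rewrite preimage_pat; exact: measurable_cyl. Qed.

(** A pointwise form of locality: such a function factors through the finite type of patterns on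
    [V], whence its measurability and integrability. *)
Definition local_on V (T : Type) (f : Om -> T) :=
  forall w w', {in V, w =1 w'} -> f w = f w'.

Lemma local_onE V (T : Type) (f : Om -> T) : local_on V f ->
  f = (f \o patext (V:=V)) \o pat V.
Proof. by move=> fV; apply/funext => w /=; apply: fV => x xV; rewrite patext_pat. Qed.

Lemma measurable_local V (dU : measure_display) (U : measurableType dU) (f : Om -> U) :
  local_on V f -> measurable_fun setT f.
Proof.
move=> /local_onE ->; apply: (@measurable_fin_comp _ Om).
exact: measurable_pat.
Qed.

Lemma integrable_local V (f : Om -> R) (m : probability Om R) :
  local_on V f -> m.-integrable setT (EFin \o f).
Proof.
move=> /local_onE ->; apply: (@integrable_fin_comp _ Om) => //.
  exact: measurable_pat.
exact: probability_setT.
Qed.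

Lemma local_ln_pr V W (m : probability Om R) : (W `<=` V)%fset ->
  local_on V (fun w => ln (pr m (cyl W w))).
Proof.
move=> /fsubsetP WV w w' ww'; rewrite (@cyl_agree W w w')// => x /WV; exact: ww'.
Qed.

Lemma measurable_ln_pr V (m : probability Om R) :
  measurable_fun setT (fun w => ln (pr m (cyl V w))).
Proof. exact: (measurable_local (local_ln_pr _ (fsubset_refl V))). Qed.

Lemma integrable_ln_pr V (m nu : probability Om R) :
  m.-integrable setT (EFin \o (fun w => ln (pr nu (cyl V w)))).
Proof. exact: (integrable_local _ (local_ln_pr _ (fsubset_refl V))). Qed.

Lemma pr_ge0 (m : probability Om R) A : 0 <= pr m A.
Proof. exact: fine_ge0. Qed.

Lemma le_pr (m : probability Om R) A B : measurable A -> measurable B ->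
  A `<=` B -> pr m A <= pr m B.
Proof.
move=> mA mB AB; rewrite fine_le ?fin_num_measure//.
by apply: le_measure => //; rewrite inE.
Qed.

Lemma pr_setT (m : probability Om R) : pr m setT = 1.
Proof. by rewrite /pr probability_setT. Qed.

Lemma cyl0 w : cyl fset0 w = setT.
Proof. by apply/seteqP; split. Qed.

Lemma cyl_sub V W w : (V `<=` W)%fset -> cyl W w `<=` cyl V w.
Proof. by move=> /fsubsetP VW v vw x /VW /vw. Qed.

(** This separates an event at the origin from one in the outside sigma-field, the shape that the
    Gibbs property asks for. *)
Lemma cyl_upd0 V w e : 0 \in V ->
  cyl V (upd0 w e) = [set v | v 0 = e] `&` cyl (V `\ 0)%fset w.
Proof.
move=> V0; apply/seteqP; split=> [v /= vw|v /= [v0 vw] x xV].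
  split; first by rewrite (vw _ V0) /upd0 eqxx.
  by move=> x; rewrite !inE => /andP[x0 /vw ->]; rewrite /upd0 (negbTE x0).
by rewrite /upd0; case: eqP => [->//|/eqP x0]; rewrite vw// !inE x0.
Qed.

Lemma pr_cyl_shift (m : probability Om R) V x w : mu_inv m ->
  pr m (cyl (fset_shift V x) (tau x w)) = pr m (cyl V w).
Proof.
(* The preimage under translation by [- x] of the cylinder on [V] is the cylinder on the shifted
   set. *)
move=> mi; rewrite /pr -(mi (- x) _ (measurable_cyl V w)); congr (fine (m _)).
apply/seteqP; split=> v /= vw y.
  move=> yV; rewrite /tau vw; last by rewrite in_fset_shift addrAC addNr add0r.
  by rewrite /tau addNKr.
by rewrite in_fset_shift => /vw; rewrite /tau [y + x]addrC addKr => ->.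
Qed.

Lemma cylB_restr n w : cylB (restr n w) = cyl (boxset d n) w.
Proof.
apply/seteqP; split=> v /= vw.
  by move=> x /imfsetP[b _ ->]; rewrite vw ffunE.
by move=> b; rewrite ffunE vw//; apply/imfsetP; exists b.
Qed.

Lemma preimage_restr n (p : Pat d E n) :
  @restr d E e0 n @^-1` [set p] = cylB p.
Proof.
apply/seteqP; split=> [w /= <- b|w /= wp]; first by rewrite ffunE.
by apply/ffunP => b; rewrite ffunE.
Qed.

Lemma measurable_restr n (p : Pat d E n) : measurable (@restr d E e0 n @^-1` [set p]).
Proof.
(* A pattern that no configuration realizes has an empty preimage; this replaces a proof that
   [restr] is onto. *)
have [[w wp]|npw] := pselect (exists w, restr n w = p).
  by rewrite preimage_restr -wp cylB_restr; exact: measurable_cyl.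
rewrite (_ : _ @^-1` _ = set0)//; apply/seteqP; split=> // w /= wp.
by apply: npw; exists w.
Qed.

End Cylinders.

(** * Single-site conditional probabilities of a Gibbs measure *)

Section Gibbs.
Context (R : realType) (d : nat) (E : finType) (e0 : E).
Local Notation Om := (Omega d e0).
Local Notation sigmaF := (@sigmaF d E e0).
Variables (gamma : {fset Zd d} -> Om -> probability Om R) (nu : probability Om R).
Hypotheses (gspec : is_specification gamma) (nuG : is_gibbs gamma nu).
Implicit Types (L V : {fset Zd d}) (w z : Om) (e : E).

Lemma measurable_gamma L (A : set Om) : measurable A ->
  measurable_fun setT (fun w => fine (gamma L w A)).
Proof.
case: gspec => mg _ mA _ B mB; rewrite setTI.
exact: sigmaF_measurable (mg L A mA B mB).
Qed.

Lemma fine_gamma_le1 L w (A : set Om) : measurable A -> fine (gamma L w A) <= 1.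
Proof.
move=> mA; rewrite -lee_fin fineK ?fin_num_measure//; exact: probability_le1.
Qed.

(** The Gibbs property writes the probability of the intersection as the integral of the kernel over
    [B], where pointwise bounds can be integrated. *)
Lemma gibbs_bounds L (A B : set Om) (lo hi : R) : measurable A ->
  sigmaF (compl L) B ->
  (forall w, B w -> lo <= fine (gamma L w A) <= hi) ->
  lo * pr nu B <= pr nu (A `&` B) <= hi * pr nu B.
Proof.
move=> mA sB lh; have mB : measurable B := sigmaF_measurable sB.
have -> : pr nu (A `&` B) = Rintegral nu B (fun w => fine (gamma L w A)).
  rewrite /pr -(nuG mA sB) /Rintegral; congr fine; apply: eq_integral => w _.
  by rewrite fineK// fin_num_measure.
have nu1 : nu setT = 1%E := probability_setT nu.
have gi : nu.-integrable B (EFin \o (fun w => fine (gamma L w A))).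
  apply: (@integrableS _ _ _ nu setT) => //.
  apply: (bounded_integrable (C := 1)) => //; first exact: measurable_gamma.
  by move=> w; rewrite ger0_norm ?fine_ge0// fine_gamma_le1.
have ci (c : R) : nu.-integrable B (EFin \o (fun=> c)).
  apply: (@integrableS _ _ _ nu setT) => //.
  exact: (bounded_integrable (C := `|c|)).
rewrite -!(Rintegral_cst nu mB); apply/andP; split.
  by apply: le_Rintegral => // w /lh /andP[].
by apply: le_Rintegral => // w /lh /andP[].
Qed.

(** Conditioning on the trivial event transfers the nonnullness bound from the kernel to [nu].
    Nonnullness concerns nonempty sets, so the empty set is treated apart. *)
Lemma gibbs_cyl_gt0 V w : 0 < pr nu (cyl V w).
Proof.
have [->|V0] := eqVneq V fset0; first by rewrite cyl0 pr_setT.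
have [a [b [a0 [_ ab]]]] := gspec.2.2.2 V V0.
have sT : sigmaF (compl V) setT.
  by rewrite -(cyl0 w); apply: sigmaF_cyl => x; rewrite inE.
have mc := measurable_cyl V w.
have lh v : setT v -> a <= fine (gamma V v (cyl V w)) <= 1.
  move=> _; rewrite fine_gamma_le1// andbT -lee_fin fineK ?fin_num_measure//.
  by have /andP[/ltW] := ab w v.
have /andP[] := gibbs_bounds mc sT lh.
by rewrite setIT pr_setT mulr1 => + _; exact: lt_le_trans.
Qed.

(** This is [gamma0] with a spin in place of its first configuration, so that this argument ranges
    over a finite type. *)
Definition spin_prob (e : E) (w : Om) : R :=
  fine (gamma [fset (0 : Zd d)]%fset w [set v | v (0 : Zd d) = e]).

Lemma gamma0E z w : gamma0 gamma z w = spin_prob (z 0) w.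
Proof. by []. Qed.

Lemma spin_prob_lower : exists2 a : R, 0 < a & forall e w, a <= spin_prob e w.
Proof.
have [|a [b [a0 [_ ab]]]] := gspec.2.2.2 [fset (0 : Zd d)]%fset.
  by apply/eqP => /fsetP /(_ 0); rewrite !inE eqxx.
exists a => // e w; have /andP[+ _] := ab (fun=> e) w.
have -> : cyl [fset (0 : Zd d)]%fset ((fun=> e) : Om) = [set v | v (0 : Zd d) = e].
  apply/seteqP; split=> v /=; first by apply; rewrite inE.
  by move=> v0 x; rewrite inE => /eqP ->.
move=> /ltW; rewrite -lee_fin fineK// fin_num_measure//.
exact: measurable_coord.
Qed.

(** The kernel at the origin is measurable with respect to the other coordinates. *)
Lemma spin_prob_agree e w w' : (forall x, x != 0 -> w x = w' x) ->
  spin_prob e w = spin_prob e w'.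
Proof.
move=> ww'; have mg := gspec.1 [fset 0]%fset _ (measurable_coord 0 e).
apply: (Fmeasurable_agree mg) => x; rewrite /compl /= => x0.
by apply: ww'; apply: contra_notN x0 => /eqP ->; rewrite inE.
Qed.

Lemma single_site_bounds V z e (lo hi : R) : 0 \in V ->
  (forall w, {in (V `\ 0)%fset, w =1 z} -> lo <= spin_prob e w <= hi) ->
  lo * pr nu (cyl (V `\ 0)%fset z) <= pr nu (cyl V (upd0 z e))
    <= hi * pr nu (cyl (V `\ 0)%fset z).
Proof.
move=> V0 lh; rewrite cyl_upd0//; apply: (@gibbs_bounds [fset 0]%fset).
- exact: measurable_coord.
- apply: sigmaF_cyl => x; rewrite !inE => /andP[/negP x0 _].
  by rewrite /compl /= inE.
- exact: lh.
Qed.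

(** For [V] containing the origin, this is the [nu]-conditional probability of the spin [e] there
    given [z] on the rest of [V]. *)
Definition site_cond V z e : R :=
  pr nu (cyl V (upd0 z e)) / pr nu (cyl (V `\ 0)%fset z).

Lemma site_cond_le1 V z e : 0 \in V -> site_cond V z e <= 1.
Proof.
move=> V0; rewrite ler_pdivrMr ?gibbs_cyl_gt0// mul1r cyl_upd0//.
apply: le_pr => //; try exact: measurable_cyl.
by apply: measurableI; [exact: measurable_coord | exact: measurable_cyl].
Qed.

Lemma site_cond_ge (a : R) V z e : (forall e w, a <= spin_prob e w) -> 0 \in V ->
  a <= site_cond V z e.
Proof.
move=> ha V0; rewrite ler_pdivlMr ?gibbs_cyl_gt0//.
have lh w : {in (V `\ 0)%fset, w =1 z} -> a <= spin_prob e w <= 1.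
  by move=> _; rewrite ha fine_gamma_le1//; exact: measurable_coord.
by have /andP[] := single_site_bounds V0 lh.
Qed.

(** The indicator of a spin value at the origin is a local function, and its integral against the
    kernel is [spin_prob]. *)
Lemma cont_spin_prob z e : Omega_gamma gamma z -> cont_at (spin_prob e) z.
Proof.
pose A : set Om := [set v | v (0 : Zd d) = e].
move=> /(_ [fset 0]%fset (\1_A)) h eps eps0.
have mA : measurable A by exact: measurable_coord.
have [|n hn] := h _ eps eps0.
  exists [fset 0]%fset => B mB.
  have sA : sigmaF [set x | x \in [fset (0 : Zd d)]%fset] A.
    by apply: sigmaF_coord; rewrite /= inE.
  pose T := g_sigma_algebraType (@coordgen d E e0 [set x | x \in [fset (0 : Zd d)]%fset]).
  have mAT : measurable (A : set T) by [].
  have := @measurable_indic _ T R setT A mAT measurableT B mB.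
  by rewrite setTI.
exists n => w /hn; rewrite /Rintegral.
by rewrite !integral_indic// !setIT.
Qed.

(* Conditioning outside the origin on a large set pins the boundary condition
   near a continuity point of the kernel. *)
Lemma site_cond_cvg z e (Vs : nat -> {fset Zd d}) : Omega_gamma gamma z ->
  (forall k, (boxset d k `<=` Vs k)%fset) ->
  site_cond (Vs k) z e @[k --> \oo] --> spin_prob e z.
Proof.
move=> zG bV; apply/cvgrPdist_le => eps eps0.
have [n hn] := cont_spin_prob e zG eps0.
near=> k.
have nk : (n <= k)%N by near: k; exact: nbhs_infty_ge.
have nV : (boxset d n `<=` Vs k)%fset := fsubset_trans (boxset_sub d nk) (bV k).
have V0 : 0 \in Vs k by apply: (fsubsetP nV); exact: boxset0.
have p0 := gibbs_cyl_gt0 (Vs k `\ 0)%fset z.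
have lh w : {in (Vs k `\ 0)%fset, w =1 z} ->
    spin_prob e z - eps <= spin_prob e w <= spin_prob e z + eps.
  (* Continuity at [z] needs agreement on the full box, while [w] is free at the origin; resetting
     that spin to [z 0] leaves the kernel unchanged. *)
  move=> wz; rewrite -ler_distl ltW// (@spin_prob_agree e w (upd0 w (z 0))); last first.
    by move=> x x0; rewrite /upd0 (negbTE x0).
  apply: hn => b; rewrite /upd0; case: eqP => [->//|/eqP b0].
  apply: wz; rewrite !inE b0; apply: (fsubsetP nV).
  by apply/imfsetP; exists b.
have /andP[h1 h2] := single_site_bounds V0 lh.
by rewrite distrC ler_distl ler_pdivlMr// h1 ler_pdivrMr.
Unshelve. all: by end_near. Qed.

End Gibbs.

(** * Interpolation between two configurations *)

Lemma Rintegral_sum (dT : measure_display) (T : measurableType dT) (R : realType)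
    (m : {measure set T -> \bar R}) (I : Type) (s : seq I) (f : I -> T -> R) :
  (forall i, m.-integrable setT (EFin \o f i)) ->
  Rintegral m setT (fun x => \sum_(i <- s) f i x) = \sum_(i <- s) Rintegral m setT (f i).
Proof.
move=> fi; rewrite /Rintegral.
under eq_integral do rewrite -sumEFin.
rewrite integral_sum//.
rewrite (eq_bigr (fun i => (fine (\int[m]_x (f i x)%:E)%E)%:E)) ?sumEFin// => i _.
by rewrite fineK//; exact: (integrable_fin_num measurableT (fi i)).
Qed.

Section Interpolation.
Context (R : realType) (d : nat) (E : finType) (e0 : E).
Local Notation Om := (Omega d e0).
Variables (gamma : {fset Zd d} -> Om -> probability Om R) (nu : probability Om R).
Hypotheses (gspec : is_specification gamma) (nuG : is_gibbs gamma nu).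
Implicit Types (V : {fset Zd d}) (p : Om * Om).

(** The change of log-probability when the spin at the origin passes from [p.1] to [p.2], the
    earlier sites having been replaced already. *)
Definition site_log V p : R :=
  ln (pr nu (cyl V (splice p.2 p.1)))
  - ln (pr nu (cyl V (upd0 (splice p.2 p.1) (p.1 0)))).

Definition log_ratio p : R :=
  ln (gamma0 gamma (splice p.2 p.1) (splice p.2 p.1)
      / gamma0 gamma p.1 (splice p.2 p.1)).

Lemma spin_prob_gt0 e w : 0 < spin_prob gamma e w.
Proof.
by have [a a0 ha] := spin_prob_lower gspec; exact: lt_le_trans (ha e w).
Qed.

Lemma log_ratioE p : log_ratio p =
  ln (spin_prob gamma (splice p.2 p.1 0) (splice p.2 p.1))
  - ln (spin_prob gamma (p.1 0) (splice p.2 p.1)).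
Proof. by rewrite /log_ratio !gamma0E ln_div// posrE spin_prob_gt0. Qed.

(** Both conditional probabilities have the same denominator, which cancels in the difference of
    logarithms. *)
Lemma site_logE V p : 0 \in V -> site_log V p =
  ln (site_cond nu V (splice p.2 p.1) (splice p.2 p.1 0))
  - ln (site_cond nu V (splice p.2 p.1) (p.1 0)).
Proof.
move=> V0; have pos := gibbs_cyl_gt0 gspec nuG.
rewrite /site_cond upd0_id !ln_div ?posrE ?pos// /site_log.
by rewrite opprB addrA subrK.
Qed.

(** Conditional probabilities lie between the nonnullness constant [a] and 1, whatever [V] is. If
    [V] misses the origin, the two cylinders coincide. *)
Lemma site_log_bounded : exists C : R, forall V p, `|site_log V p| <= C.
Proof.
have [a a0 ha] := spin_prob_lower gspec.
have a1 : a <= 1.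
  rewrite (le_trans (ha e0 (fun=> e0)))// fine_gamma_le1//.
  exact: measurable_coord.
exists (- ln a) => V p; have [V0|V0] := boolP (0 \in V); last first.
  rewrite /site_log (@cyl_agree _ _ _ V _ (splice p.2 p.1)).
    by rewrite subrr normr0 oppr_ge0 ln_le0.
  move=> x xV; rewrite /upd0; case: eqP => // x0.
  by rewrite -x0 xV in V0.
rewrite site_logE//; set z := splice _ _.
have lnb e : ln a <= ln (site_cond nu V z e) <= 0.
  rewrite ln_le0 ?(site_cond_le1 gspec nuG)// andbT ler_ln ?posrE//.
    exact: (site_cond_ge gspec nuG).
  by apply: lt_le_trans a0 _; exact: (site_cond_ge gspec nuG).
move: (lnb (z 0)) (lnb (p.1 0)) => /andP[h1 h2] /andP[h3 h4].
by rewrite ler_norml; lra.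
Qed.

Lemma measurable_site_log V : measurable_fun setT (site_log V).
Proof.
apply: measurable_funB.
  exact: (measurableT_comp (measurable_ln_pr V nu) (@measurable_splice d E e0)).
exact: (measurableT_comp (measurable_ln_pr V nu) (@measurable_upd0_splice d E e0)).
Qed.

Lemma measurable_spin_prob (dT : measure_display) (T : measurableType dT)
    (f g : T -> Om) : measurable_fun setT f -> measurable_fun setT g ->
  measurable_fun setT (fun t => spin_prob gamma (f t 0) (g t)).
Proof.
move=> mf mg; pose A e : set Om := [set v | v (0 : Zd d) = e].
(* Splitting according to the finitely many spins leaves kernels of fixed events, whose
   measurability is known. *)
have -> : (fun t => spin_prob gamma (f t 0) (g t)) =
    (fun t => \sum_e \1_(A e) (f t) * spin_prob gamma e (g t)).
  apply/funext => t; rewrite (bigD1 (f t 0))//= indicE mem_set// mul1r.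
  rewrite big1 ?addr0// => e /eqP ne; rewrite indicE memNset ?mul0r//.
  by move=> /esym.
apply: measurable_sum => e; apply: measurable_funM.
  apply: (measurableT_comp _ mf); apply: measurable_indic.
  exact: measurable_coord.
apply: (measurableT_comp _ mg); apply: measurable_gamma => //.
exact: measurable_coord.
Qed.

Lemma measurable_log_ratio : measurable_fun setT log_ratio.
Proof.
rewrite (funext log_ratioE); apply: measurable_funB.
  apply: (measurableT_comp (@measurable_ln R)).
  exact: (@measurable_spin_prob _ _ (fun p => splice p.2 p.1) _
    (@measurable_splice d E e0) (@measurable_splice d E e0)).
apply: (measurableT_comp (@measurable_ln R)).
exact: (@measurable_spin_prob _ _ fst _ measurable_fst (@measurable_splice d E e0)).
Qed.

Lemma site_log_cvg p (Vs : nat -> {fset Zd d}) :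
  Omega_gamma gamma (splice p.2 p.1) ->
  (forall k, (boxset d k `<=` Vs k)%fset) ->
  site_log (Vs k) p @[k --> \oo] --> log_ratio p.
Proof.
move=> pG bV.
have V0 k : 0 \in Vs k by apply: (fsubsetP (bV k)); exact: boxset0.
rewrite log_ratioE; under eq_fun do rewrite site_logE//.
have lnc e : ln (site_cond nu (Vs k) (splice p.2 p.1) e) @[k --> \oo] -->
    ln (spin_prob gamma e (splice p.2 p.1)).
  apply: (@cvg_comp _ _ _ (fun k => site_cond nu (Vs k) (splice p.2 p.1) e) (@ln R)).
    exact: (site_cond_cvg gspec nuG).
  by apply: continuous_ln; exact: spin_prob_gt0.
exact: cvgB.
Qed.

Variables (mu lambda : probability Om R).
Local Notation P := (lambda \x mu)%E.

(** Uniformity over all large [V] is obtained by contradiction: a choice of bad sets [Vs k] gives a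
    sequence to which dominated convergence applies. *)
Lemma Rintegral_site_log_cvg (eps : R) : condC1' gamma lambda mu -> 0 < eps ->
  exists k, forall V, (boxset d k `<=` V)%fset ->
    `|Rintegral P setT (site_log V) - Rintegral P setT log_ratio| <= eps.
Proof.
move=> [A [mA [AG PA]]] eps0; apply: contrapT => /forallNP H.
have /choice[Vs hVs] : forall k, exists V, (boxset d k `<=` V)%fset /\
    eps < `|Rintegral P setT (site_log V) - Rintegral P setT log_ratio|.
  move=> k; apply: contrapT => /forallNP h; apply: (H k) => V bV.
  by rewrite leNgt; apply/negP => ltV; apply: (h V).
have [C hC] := site_log_bounded.
have P1 : P setT = 1%E by exact: probability_setT.
have [|||||intf _] := @dominated_convergence _ _ _ P setT measurableT
  (fun n => EFin \o site_log (Vs n)) (EFin \o log_ratio) (cst C%:E).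
- by move=> n; apply/measurable_EFinP; exact: measurable_site_log.
- by apply/measurable_EFinP; exact: measurable_log_ratio.
(* The complement of the full-measure set [A] of the condition is a null set outside of which the
   splice is a continuity point. *)
- exists (~` A); split; first exact: measurableC.
    transitivity (1 - P A)%E; last by rewrite PA subee.
    exact: (@probability_setC _ _ _ P A mA).
  move=> p /= np Ap; apply: np => _; apply: cvg_EFin; first by near=> n.
  by apply: site_log_cvg => [|k]; [exact: AG | exact: (hVs k).1].
- exact: (bounded_integrable (f := cst C) (C := `|C|)).
- by apply: aeW => p n _; rewrite /= lee_fin.
have fR : (\int[P]_x (log_ratio x)%:E = (Rintegral P setT log_ratio)%:E)%E.
  by rewrite fineK//; exact: integrable_fin_num.
rewrite [X in _ --> X -> _]fR => /fine_cvg /cvgrPdist_lt /(_ _ eps0) [k _ hk].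
have := hk k (leqnn k); rewrite distrC => /lt_trans /(_ (hVs k).2).
by rewrite ltxx.
Unshelve. all: by end_near. Qed.

End Interpolation.

(** * Telescoping over a box and integration against the product measure *)

Section Telescope.
Context (R : realType) (d : nat) (E : finType) (e0 : E).
Local Notation Om := (Omega d e0).
Implicit Types (V : {fset Zd d}) (p : Om * Om).

Definition tau2 (x : Zd d) (p : Om * Om) : Om * Om := (tau x p.1, tau x p.2).

Lemma measurable_tau2 x : measurable_fun setT (tau2 x).
Proof.
apply: measurable_fun_pair.
  exact: (measurableT_comp (@measurable_tau d E e0 x) measurable_fst).
exact: (measurableT_comp (@measurable_tau d E e0 x) measurable_snd).
Qed.

(** Translating [x] to the origin turns the mixture that has replaced the sites up to [x] into a
    splice, and the one that stops just before [x] into the same splice reset at the origin. *)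
Lemma telescope_ln_pr (nu : probability Om R) V p : mu_inv nu ->
  ln (pr nu (cyl V p.2)) - ln (pr nu (cyl V p.1)) =
  \sum_(x <- V) site_log nu (fset_shift V x) (tau2 x p).
Proof.
move=> nui; pose mix (Q : pred (Zd d)) : Om := fun y => if Q y then p.2 y else p.1 y.
pose Phi (W : {fset Zd d}) := ln (pr nu (cyl V (mix (mem W)))).
have -> : ln (pr nu (cyl V p.2)) - ln (pr nu (cyl V p.1)) = Phi V - Phi fset0.
  congr (ln (pr nu _) - ln (pr nu _)); apply: cyl_agree => y yV; rewrite /mix //=.
  by rewrite yV.
rewrite lex_telescope big_seq [RHS]big_seq; apply: eq_bigr => x xV.
rewrite /site_log; congr (ln _ - ln _).
  transitivity (pr nu (cyl V (mix (fun y => lexle y x)))).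
    by congr (pr nu _); apply: cyl_agree => y yV; rewrite /mix /= !inE yV.
  rewrite -(pr_cyl_shift _ x _ nui); congr (pr nu (cyl _ _)).
  apply/funext => y; rewrite /splice /tau2 /tau /mix /=.
  by rewrite -lexle_subr0 addrAC subrr add0r.
transitivity (pr nu (cyl V (mix (fun y => lexle y x && (y != x))))).
  by congr (pr nu _); apply: cyl_agree => y yV; rewrite /mix /= !inE yV.
rewrite -(pr_cyl_shift _ x _ nui); congr (pr nu (cyl _ _)).
apply/funext => y; rewrite /upd0 /splice /tau2 /tau /mix /=.
rewrite -lexle_subr0 addrAC subrr add0r -subr_eq0 addrAC subrr add0r.
by have [->|y0] := eqVneq y 0; rewrite ?andbF ?andbT.
Qed.

Variables (mu lambda : probability Om R).
Local Notation P := (lambda \x mu)%E.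

(** The image measure agrees with the product on rectangles, hence everywhere by uniqueness of the
    product measure. *)
Lemma product_tau2 x (A : set (Om * Om)) : mu_inv mu -> mu_inv lambda ->
  measurable A -> P (tau2 x @^-1` A) = P A.
Proof.
move=> mui lai mA; have mt := measurable_tau2 x.
pose m' := (pushforward P (tau2 x) : {measure set (Om * Om) -> \bar R}).
rewrite [RHS](@product_measure_unique _ _ _ _ _ lambda mu (m' mt))// => B C mB mC.
rewrite /m' /= /pushforward.
have -> : tau2 x @^-1` (B `*` C) = (tau x @^-1` B) `*` (tau x @^-1` C) by [].
have mtau (D : set Om) : measurable D -> measurable (tau x @^-1` D).
  by move=> mD; have := measurable_tau x measurableT mD; rewrite setTI.
rewrite product_measure1E; [|exact: mtau..].
by congr (_ * _)%E; [exact: lai | exact: mui].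
Qed.

Lemma product_fst (A : set Om) : measurable A -> P (fst @^-1` A) = lambda A.
Proof.
move=> mA; have -> : fst @^-1` A = A `*` (setT : set Om).
  by apply/seteqP; split=> [p /= pA|p /= []].
transitivity (lambda A * mu setT)%E; first exact: product_measure1E.
by rewrite [X in (_ * X)%E](probability_setT mu) mule1.
Qed.

Lemma product_snd (A : set Om) : measurable A -> P (snd @^-1` A) = mu A.
Proof.
move=> mA; have -> : snd @^-1` A = (setT : set Om) `*` A.
  by apply/seteqP; split=> [p /= pA|p /= []].
transitivity (lambda setT * mu A)%E; first exact: product_measure1E.
by rewrite [X in (X * _)%E](probability_setT lambda) mul1e.
Qed.

Variables (gamma : {fset Zd d} -> Om -> probability Om R) (nu : probability Om R).
Hypotheses (gspec : is_specification gamma) (nuG : is_gibbs gamma nu).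
Hypotheses (nui : mu_inv nu) (mui : mu_inv mu) (lai : mu_inv lambda).

Lemma integrable_site_log_tau2 V x :
  P.-integrable setT (EFin \o (site_log nu V \o tau2 x)).
Proof.
have [C hC] := site_log_bounded gspec nuG.
apply: (bounded_integrable (C := C)); first exact: probability_setT.
  exact: (measurableT_comp (measurable_site_log nu V) (measurable_tau2 x)).
by move=> p; exact: hC.
Qed.

Lemma Rintegral_site_log_tau2 V x :
  Rintegral P setT (site_log nu V \o tau2 x) = Rintegral P setT (site_log nu V).
Proof.
apply: Rintegral_image.
- exact: measurable_tau2.
- by move=> A mA; exact: product_tau2.
- exact: measurable_site_log.
- exact: integrable_site_log_tau2.
Qed.

(** Both integrals are lifted to the product space through its marginals; there the integrand
    telescopes, and joint invariance removes the translation from each term. *)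
Lemma Rintegral_ln_pr_sub V :
  Rintegral mu setT (fun w => ln (pr nu (cyl V w)))
  - Rintegral lambda setT (fun w => ln (pr nu (cyl V w))) =
  \sum_(x <- V) Rintegral P setT (site_log nu (fset_shift V x)).
Proof.
pose f (w : Om) := ln (pr nu (cyl V w)).
(* As [f] depends only on the pattern on [V], the sum of its absolute values over all patterns is a
   bound. *)
have [B hB] : exists B, forall w, `|f w| <= B.
  exists (\sum_(q : {ffun V -> E}) `|f (patext e0 q)|) => w.
  have -> : f w = f (patext e0 (pat V w)).
    by apply: (local_ln_pr nu (fsubset_refl V)) => x xV; rewrite patext_pat.
  by rewrite (bigD1 (pat V w))//= lerDl sumr_ge0.
have mf : measurable_fun setT f := measurable_ln_pr V nu.
have P1 : P setT = 1%E by exact: probability_setT.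
have fi1 : P.-integrable setT (EFin \o (f \o fst)).
  apply: (bounded_integrable (C := B)) => //.
    exact: (measurableT_comp mf measurable_fst).
  by move=> p; exact: hB.
have fi2 : P.-integrable setT (EFin \o (f \o snd)).
  apply: (bounded_integrable (C := B)) => //.
    exact: (measurableT_comp mf measurable_snd).
  by move=> p; exact: hB.
rewrite -(Rintegral_image measurable_fst product_fst mf fi1).
rewrite -(Rintegral_image measurable_snd product_snd mf fi2).
rewrite -RintegralB//.
rewrite [RHS](eq_bigr (fun x => Rintegral P setT
  (site_log nu (fset_shift V x) \o tau2 x))); last first.
  by move=> x _; rewrite Rintegral_site_log_tau2.
rewrite -Rintegral_sum; last by move=> x; exact: integrable_site_log_tau2.
by apply: eq_Rintegral => p _; rewrite -telescope_ln_pr.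
Qed.

Lemma e_seqE (m : probability Om R) n : e_seq m nu n =
  - Rintegral m setT (fun w => ln (pr nu (cyl (boxset d n) w))) / vol d R n.
Proof.
by rewrite /e_seq; congr (- _ / _); apply: eq_Rintegral => w _; rewrite cylB_restr.
Qed.

(** The difference is a box average of integrals of [site_log], which are uniformly bounded and
    converge as the set grows, so [box_average_cvg] applies. *)
Lemma e_seq_sub_cvg : condC1' gamma lambda mu ->
  e_seq lambda nu n - e_seq mu nu n @[n --> \oo] -->
  Rintegral P setT (log_ratio gamma).
Proof.
move=> C1; have [C hC] := site_log_bounded gspec nuG.
have := @box_average_cvg R d (fun V => Rintegral P setT (site_log nu V))
  (Rintegral P setT (log_ratio gamma)) C.
have -> : (fun n => e_seq lambda nu n - e_seq mu nu n) = (fun n =>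
    (\sum_(x <- boxset d n) Rintegral P setT
       (site_log nu (fset_shift (boxset d n) x))) / vol d R n).
  apply/funext => n; rewrite -Rintegral_ln_pr_sub !e_seqE -mulrBl.
  by rewrite opprK addrC.
apply=> [V _|eps eps0]; last exact: Rintegral_site_log_cvg.
apply: normr_Rintegral_le => //; first exact: probability_setT.
exact: measurable_site_log.
Qed.

End Telescope.

(** * Existence of the entropy density *)

Section Entropy.
Context (R : realType) (d : nat) (E : finType) (e0 : E).
Local Notation Om := (Omega d e0).
Variable mu : probability Om R.
Implicit Types (A B V : {fset Zd d}) (w : Om).

(** The Shannon entropy of the marginal of [mu] on [V]. *)
Definition ent V : R := - Rintegral mu setT (fun w => ln (pr mu (cyl V w))).

Lemma ent0 : ent fset0 = 0.
Proof.
rewrite /ent (_ : (fun w => _) = fun=> 0); last first.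
  by apply/funext => w; rewrite cyl0 pr_setT ln1.
by rewrite Rintegral_cst// mul0r oppr0.
Qed.

Lemma ent_shift V x : mu_inv mu -> ent (fset_shift V x) = ent V.
Proof.
move=> mui; rewrite /ent; congr (- _).
transitivity (Rintegral mu setT
    ((fun w => ln (pr mu (cyl (fset_shift V x) w))) \o tau x)).
  apply/esym; apply: Rintegral_image.
  - exact: measurable_tau.
  - exact: mui.
  - exact: measurable_ln_pr.
  - rewrite (_ : _ \o tau x = fun w => ln (pr mu (cyl V w))).
      exact: integrable_ln_pr.
    by apply/funext => w /=; rewrite pr_cyl_shift.
by apply: eq_Rintegral => w _; rewrite /= pr_cyl_shift.
Qed.

Section OneSite.
Variable B : {fset Zd d}.
Hypothesis B0 : 0 \notin B.

(** Keeping the spin at the origin as a separate component allows summing over it alone. *)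
Definition pat0 w := (pat B w, w 0).
Definition pat0ext (k : {ffun B -> E} * E) : Om := upd0 (patext e0 k.1) k.2.

Lemma preimage_pat0 k : pat0 @^-1` [set k] = cyl (0 |` B)%fset (pat0ext k).
Proof.
case: k => q e; rewrite cyl_upd0 ?fset1U1// fsetU1K// -preimage_pat.
by apply/seteqP; split=> w /=; [case=> <- <- | case=> <- <-].
Qed.

Lemma measurable_pat0 k : measurable (pat0 @^-1` [set k]).
Proof. by rewrite preimage_pat0; exact: measurable_cyl. Qed.

Lemma pat0extE V w : (V `<=` 0 |` B)%fset -> {in V, pat0ext (pat0 w) =1 w}.
Proof.
move=> /fsubsetP VB x /VB; rewrite /pat0ext /upd0 !inE.
by case: eqP => [->//|_] /= xB; rewrite patext_pat.
Qed.

Lemma ent_pat0 V : (V `<=` 0 |` B)%fset ->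
  ent V = - \sum_k pr mu (cyl (0 |` B)%fset (pat0ext k))
                     * ln (pr mu (cyl V (pat0ext k))).
Proof.
move=> VB; rewrite /ent; congr (- _).
under [RHS]eq_bigr do rewrite -preimage_pat0.
rewrite -(Rintegral_fin_comp (fun k => ln (pr mu (cyl V (pat0ext k)))) measurable_pat0).
by apply: eq_Rintegral => w _; rewrite /= (cyl_agree (pat0extE w VB)).
Qed.

Lemma pr_pat0ext A q e : (A `<=` B)%fset ->
  pr mu (cyl A (pat0ext (q, e))) = pr mu (cyl A (patext e0 q)).
Proof.
move=> /fsubsetP AB; congr (pr mu _); apply: cyl_agree => x /AB xB.
by rewrite /pat0ext /upd0 /=; case: eqP => // x0; rewrite x0 (negbTE B0) in xB.
Qed.

Lemma sum_pr_pat0ext A q : (A `<=` B)%fset ->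
  \sum_e pr mu (cyl (0 |` A)%fset (pat0ext (q, e))) = pr mu (cyl A (patext e0 q)).
Proof.
move=> AB; have A0 : 0 \notin A by apply: contra B0; exact: (fsubsetP AB).
have mX e : measurable ((fun w : Om => w 0) @^-1` [set e]) by exact: measurable_coord.
rewrite [RHS](fine_measure_partition mu mX (measurable_cyl _ _)).
by apply: eq_bigr => e _; rewrite cyl_upd0 ?fset1U1// fsetU1K// setIC.
Qed.

Lemma sum_pr_pat : \sum_(q : {ffun B -> E}) pr mu (cyl B (patext e0 q)) = 1.
Proof.
rewrite -(pr_setT mu) [RHS](fine_measure_partition mu (@measurable_pat d E e0 B) measurableT).
by apply: eq_bigr => q _; rewrite setTI preimage_pat.
Qed.

Lemma sum_pr_pat0 : \sum_k pr mu (cyl (0 |` B)%fset (pat0ext k)) = 1.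
Proof.
rewrite -(pr_setT mu) [RHS](fine_measure_partition mu measurable_pat0 measurableT).
by apply: eq_bigr => q _; rewrite setTI preimage_pat0.
Qed.

(* [ln t <= t - 1] applied to the ratio of conditional probabilities given the
   patterns on [A] and on [B]. *)
Lemma cond_ent_le A : (A `<=` B)%fset ->
  ent (0 |` B)%fset - ent B <= ent (0 |` A)%fset - ent A.
Proof.
move=> AB; have A0B : (0 |` A `<=` 0 |` B)%fset by exact: fsetUS.
have BB : (B `<=` 0 |` B)%fset by exact: fsubsetUr.
have AB' : (A `<=` 0 |` B)%fset := fsubset_trans AB BB.
have A0A : (A `<=` 0 |` A)%fset by exact: fsubsetUr.
rewrite !ent_pat0//.
pose m V k := pr mu (cyl V (pat0ext k)).
have m0 V k : 0 <= m V k by exact: pr_ge0.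
have lem V V' k : (V `<=` V')%fset -> m V' k <= m V k.
  by move=> VV; apply: le_pr; [exact: measurable_cyl.. | exact: cyl_sub].
rewrite !opprK -!/(m _ _).
suff : \sum_k m (0 |` B)%fset k * (ln (m (0 |` A)%fset k) - ln (m A k)
          - ln (m (0 |` B)%fset k) + ln (m B k)) <= 0.
  under eq_bigr do rewrite mulrDr !mulrBr.
  rewrite big_split !sumrB /= => h.
  by move: h; lra.
apply: (@le_trans _ _ (\sum_k (m (0 |` A)%fset k * m B k / m A k - m (0 |` B)%fset k))).
  apply: ler_sum => k _; have [p0|p0] := eqVneq (m (0 |` B)%fset k) 0.
    by rewrite p0 mul0r subr0 divr_ge0// mulr_ge0.
  have pos : 0 < m (0 |` B)%fset k by rewrite lt_neqAle eq_sym p0 m0.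
  have posV V : (V `<=` 0 |` B)%fset -> 0 < m V k.
    by move=> VB; exact: lt_le_trans pos (lem _ _ k VB).
  have pA := posV _ AB'; have pB := posV _ BB; have pA0 := posV _ A0B.
  (* [t] is the conditional probability of the spin at the origin given the pattern on [A], divided
     by the one given the pattern on [B]. *)
  set t := m (0 |` A)%fset k * m B k / (m A k * m (0 |` B)%fset k).
  have t0 : 0 < t by rewrite divr_gt0// mulr_gt0.
  have -> : ln (m (0 |` A)%fset k) - ln (m A k) - ln (m (0 |` B)%fset k) + ln (m B k)
      = ln t.
    by rewrite ln_div ?posrE ?mulr_gt0// !lnM ?posrE//; ring.
  have -> : m (0 |` A)%fset k * m B k / m A k - m (0 |` B)%fset k
      = m (0 |` B)%fset k * (t - 1).
    by rewrite /t; field; rewrite !gt_eqF.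
  rewrite ler_wpM2l//; have := @le_ln1Dx R (t - 1).
  by rewrite addrCA subrr addr0; apply; lra.
rewrite sumrB sum_pr_pat0 subr_le0 -sum_pr_pat.
rewrite (eq_bigr (fun k => m (0 |` A)%fset (k.1, k.2) * m B (k.1, k.2) / m A (k.1, k.2)));
  last by case.
(* For a fixed pattern [q] on [B], summing over the spin [e] replaces the first factor by the
   probability of the pattern on [A], which cancels the denominator. *)
rewrite -(pair_bigA _ (fun q e => m (0 |` A)%fset (q, e) * m B (q, e) / m A (q, e))) /=.
apply: ler_sum => q _.
under eq_bigr do rewrite {2 3}/m !pr_pat0ext// -mulrA.
rewrite -mulr_suml sum_pr_pat0ext// mulrCA ler_piMr ?pr_ge0//.
(* On a null pattern the quotient is 0 rather than 1, so only an inequality holds. *)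
have [->|n0] := eqVneq (pr mu (cyl A (patext e0 q))) 0; first by rewrite mul0r.
by rewrite divff.
Qed.

(** Each term is nonnegative because the larger set has the smaller cylinder. *)
Lemma cond_ent_ge0 : 0 <= ent (0 |` B)%fset - ent B.
Proof.
have BB : (B `<=` 0 |` B)%fset by exact: fsubsetUr.
rewrite !ent_pat0// opprK addrC -sumrB sumr_ge0// => k _; rewrite -mulrBr.
have [->|p0] := eqVneq (pr mu (cyl (0 |` B)%fset (pat0ext k))) 0; first by rewrite mul0r.
have pos : 0 < pr mu (cyl (0 |` B)%fset (pat0ext k)).
  by rewrite lt_neqAle eq_sym p0 pr_ge0.
have le : pr mu (cyl (0 |` B)%fset (pat0ext k)) <= pr mu (cyl B (pat0ext k)).
  by apply: le_pr; [exact: measurable_cyl.. | exact: cyl_sub].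
by rewrite mulr_ge0 ?pr_ge0// subr_ge0 ler_ln// posrE// (lt_le_trans pos).
Qed.

End OneSite.

Definition past V : {fset Zd d} := [fset y in V | lexle y 0 && (y != 0)]%fset.

(** The conditional entropy of the spin at the origin given its lexicographic past inside [V]. *)
Definition past_ent V : R := ent (0 |` past V)%fset - ent (past V).

Lemma past0 V : 0 \notin past V.
Proof. by rewrite !inE eqxx !andbF. Qed.

Lemma past_sub A V : (A `<=` V)%fset -> (past A `<=` past V)%fset.
Proof.
move=> /fsubsetP AV; apply/fsubsetP => x; rewrite !inE => /andP[xA ->].
by rewrite (AV _ xA).
Qed.

Lemma past_ent_le A V : (A `<=` V)%fset -> past_ent V <= past_ent A.
Proof. by move=> /past_sub; apply: cond_ent_le; exact: past0. Qed.

Lemma past_ent_ge0 V : 0 <= past_ent V.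
Proof. exact/cond_ent_ge0/past0. Qed.

(** The chain rule for entropy along the lexicographic order, each term being translated to the
    origin. *)
Lemma ent_telescope V : mu_inv mu ->
  ent V = \sum_(x <- V) past_ent (fset_shift V x).
Proof.
move=> mui; have -> : ent V = ent V - ent fset0 by rewrite ent0 subr0.
rewrite (lex_telescope ent V).
apply: eq_big_seq => x xV; rewrite /past_ent.
have lx y : lexle (y + x) x = lexle y 0 by rewrite -lexle_subr0 addrK.
have ex y : (y + x == x) = (y == 0) by rewrite -subr_eq0 addrK.
rewrite -(ent_shift [fset y in V | lexle y x]%fset x mui).
rewrite -(ent_shift [fset y in V | lexle y x && (y != x)]%fset x mui).
congr (ent _ - ent _); apply/fsetP => y; rewrite in_fset_shift.
  rewrite in_fset1U /past !in_fset /= !inE /= in_fset_shift lx.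
  by have [->|] := eqVneq y 0; rewrite ?add0r ?xV ?lexlexx ?andbT.
by rewrite /past !in_fset /= !inE /= in_fset_shift lx ex.
Qed.

(** The limit is the infimum of [past_ent]: by monotonicity, a set that nearly attains it controls
    every larger set, and the empty set provides the uniform bound. *)
Lemma ent_density_cvg : mu_inv mu ->
  exists l : R, ent (boxset d n) / vol d R n @[n --> \oo] --> l.
Proof.
move=> mui; pose S := [set past_ent V | V in setT].
have S0 : S !=set0 by exists (past_ent fset0), fset0.
have Slb : has_lbound S by exists 0 => _ [V _ <-]; exact: past_ent_ge0.
exists (inf S).
under eq_fun do rewrite ent_telescope//.
apply: (@box_average_cvg R d past_ent (inf S) (past_ent fset0)) => [V _|eps eps0].
  by rewrite ger0_norm ?past_ent_ge0// past_ent_le// fsub0set.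
have [_ [V _ <-] ltV] := inf_adherent eps0 (conj S0 Slb).
have [k Vk] := fset_sub_boxset V; exists k => W kW.
have h1 : inf S <= past_ent W by apply: ge_inf => //; exists W.
have h2 := past_ent_le (fsubset_trans Vk kW).
by rewrite ger0_norm ?subr_ge0// lerBlDl (le_trans h2)// ltW.
Qed.

End Entropy.

(** * The three densities as combinations of [e_seq] *)

Section Densities.
Context (R : realType) (d : nat) (E : finType) (e0 : E).
Local Notation Om := (Omega d e0).

Lemma e_seq_sum (m nu : probability Om R) n : e_seq m nu n =
  - (\sum_(p : Pat d E n) pr m (cylB p) * ln (pr nu (@cylB d E e0 n p))) / vol d R n.
Proof.
rewrite /e_seq; congr (- _ / _).
rewrite [LHS](Rintegral_fin_comp (fun p => ln (pr nu (cylB p))) (@measurable_restr d E e0 n)).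
by apply: eq_bigr => p _; rewrite preimage_restr.
Qed.

(** The convention for null patterns agrees with multiplication by a zero weight. *)
Lemma hKS_seqE (mu : probability Om R) n : hKS_seq mu n = e_seq mu mu n.
Proof.
rewrite e_seq_sum /hKS_seq; congr (- _ / _); apply: eq_bigr => p _.
by case: eqP => // ->; rewrite mul0r.
Qed.

Lemma hKS_seq_cvg (mu : probability Om R) : mu_inv mu -> hKS_seq mu @ \oo --> hKS mu.
Proof.
move=> mui; have [l hl] := ent_density_cvg mui.
have hl' : hKS_seq mu @ \oo --> l.
  rewrite (_ : hKS_seq mu = fun n => ent mu (boxset d n) / vol d R n)//.
  by apply/funext => n; rewrite hKS_seqE e_seqE.
by rewrite /hKS (cvg_lim _ hl').
Qed.

Lemma hrel_seqE (mu nu : probability Om R) n : (forall V w, 0 < pr nu (cyl V w)) ->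
  hrel_seq mu nu n = - hKS_seq mu n + e_seq mu nu n.
Proof.
move=> nu0; rewrite hKS_seqE !e_seq_sum /hrel_seq -mulNr opprK -mulrDl; congr (_ / _).
rewrite /hLam -sumrB; apply: eq_bigr => p _.
case: eqP => [->|/eqP p0]; first by rewrite !mul0r subr0.
(* A pattern of positive probability is realized by some [w], which turns [cylB p] into a cylinder
   charged by [nu]. *)
have [w wp] : exists w : Om, restr n w = p.
  apply: contrapT => np; case/eqP: p0; rewrite -preimage_restr.
  rewrite (_ : _ @^-1` _ = set0) /pr ?measure0//.
  by apply/seteqP; split=> // w /= wp; apply: np; exists w.
rewrite -mulrBr ln_div// posrE; first by rewrite lt_neqAle eq_sym p0 pr_ge0.
by rewrite -wp cylB_restr.
Qed.

Lemma rn_seqE (lambda mu nu : probability Om R) n :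
  (forall V w, 0 < pr nu (cyl V w)) -> (forall V w, 0 < pr mu (cyl V w)) ->
  rn_seq lambda mu nu n = e_seq lambda nu n - e_seq lambda mu n.
Proof.
move=> nu0 mu0; rewrite !e_seqE /rn_seq -mulrBl; congr (_ / _).
rewrite opprK addrC -RintegralB//; try exact: integrable_ln_pr.
by apply: eq_Rintegral => w _; rewrite cylB_restr ln_div ?posrE.
Qed.

End Densities.

Theorem theorem3p9 (R : realType) (d : nat) (E : finType) (e0 : E)
    (gamma : {fset Zd d} -> Omega d e0 -> probability (Omega d e0) R)
    (nu mu lambda : probability (Omega d e0) R) :
  is_specification gamma ->
  spec_translation_invariant gamma ->
  is_gibbs gamma nu -> mu_inv nu ->
  mu_inv mu -> mu_inv lambda ->
  condC1' gamma lambda mu ->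
  (* (1) *)
  (((exists l : R, hrel_seq mu nu @ \oo --> l) <->
    (exists l : R, e_seq lambda nu @ \oo --> l)) /\
   (forall e : R, e_seq lambda nu @ \oo --> e ->
      hrel_seq mu nu @ \oo -->
        - hKS mu + e
        - Rintegral (lambda \x mu)%E setT
            (fun p : Omega d e0 * Omega d e0 =>
               ln (gamma0 gamma (splice p.2 p.1) (splice p.2 p.1)
                   / gamma0 gamma p.1 (splice p.2 p.1))))) /\
  (* (2) *)
  (is_gibbs gamma mu -> (exists e : R, e_seq lambda nu @ \oo --> e) ->
   exists h : R, hrel_seq mu nu @ \oo --> h /\
                 rn_seq lambda mu nu @ \oo --> h).
Proof.
move=> gspec _ nuG nui mui lai C1.
have nu0 := gibbs_cyl_gt0 gspec nuG.
have cK := hKS_seq_cvg mui.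
have cD := e_seq_sub_cvg gspec nuG nui mui lai C1.
rewrite -[X in Rintegral _ _ X]/(log_ratio gamma).
set I := Rintegral _ _ (log_ratio gamma) in cD *.
(* The first and last sequences converge in any case, so [hrel_seq mu nu] and [e_seq lambda nu]
   converge together; [eE] is the same identity solved for the latter. *)
have hE : hrel_seq mu nu = fun n => - hKS_seq mu n + e_seq lambda nu n
    - (e_seq lambda nu n - e_seq mu nu n).
  by apply/funext => n; rewrite hrel_seqE//; ring.
have eE : e_seq lambda nu = fun n => hrel_seq mu nu n + hKS_seq mu n
    + (e_seq lambda nu n - e_seq mu nu n).
  by apply/funext => n; rewrite hrel_seqE//; ring.
have hcvg e : e_seq lambda nu @ \oo --> e -> hrel_seq mu nu @ \oo --> - hKS mu + e - I.
  by move=> ce; rewrite hE; apply: cvgB => //; apply: cvgD => //; exact: cvgN.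
split; first split=> //.
  split=> [[l hl]|[e /hcvg he]]; last by eexists; exact: he.
  by exists (l + hKS mu + I); rewrite eE; apply: cvgD => //; exact: cvgD.
move=> muG [e ce]; exists (- hKS mu + e - I); split; first exact: hcvg.
have mu0 := gibbs_cyl_gt0 gspec muG.
(* With [nu := mu] the same limit compares [e_seq lambda mu] with the entropy. *)
have cM := e_seq_sub_cvg gspec muG mui mui lai C1.
(* The limit in [cM] is again [I], because [log_ratio] depends on [gamma] and not on the chosen
   Gibbs measure; hence both sequences have the same limit. *)
have -> : rn_seq lambda mu nu = fun n => - hKS_seq mu n + e_seq lambda nu n
    - (e_seq lambda mu n - e_seq mu mu n).
  by apply/funext => n; rewrite rn_seqE// hKS_seqE; ring.
by apply: cvgB => //; apply: cvgD => //; exact: cvgN.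
Qed.
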